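(* Let $n\ge 4$. Any canal space-like hypersurface of parabolic type in the Minkowski space $\mathbb{R}^{n+1}_1$ is a Riemannian manifold of quasi-constant sectional curvatures with function $a+k^2=0$.
   Context: QC-manifolds. $(M,g,\xi)$ denotes an $n$-dimensional Riemannian manifold with metric $g$ and a unit vector field $\xi$; $\eta(X)=g(\xi,X)$, and $\Delta(p)=\{X\in T_pM:\eta(X)=0\}$. $(M,g,\xi)$ is a Riemannian manifold of quasi-constant sectional curvatures (Riemannian QC-manifold) if for every $p\in M$ and every 2-plane $E\subset T_pM$ the sectional curvature of $E$ depends only on $p$ and on the angle between $E$ and $\xi$. Equivalently, the curvature tensor has the form $\mathcal R=a\,\pi+b\,\Phi$ for some functions $a,b$ on $M$, where $\pi(X,Y,Z,U)=g(Y,Z)g(X,U)-g(X,Z)g(Y,U)$ and $\Phi(X,Y,Z,U)=g(Y,Z)\eta(X)\eta(U)-g(X,Z)\eta(Y)\eta(U)+g(X,U)\eta(Y)\eta(Z)-g(Y,U)\eta(X)\eta(Z)$ (sign convention: $\mathcal R=c\,\pi$ means constant sectional curvature $c$). The function $k$ is defined by $\nabla_x\xi=k\,x$ for $x\in\Delta$ (when $b\ne0$, $k=\xi(a)/(2b)$), where $\nabla$ is the Levi-Civita connection of $g$. Canal space-like hypersurfaces. $\mathbb{R}^{n+1}_1$ is Minkowski space with scalar product of signature $(n,1)$; products of vectors are scalar products. A hypersurface $M$ of dimension $n$ is space-like if the induced metric is positive definite. A space-like hypersphere with center $z$ and radius $R>0$ is $\{Z:(Z-z)^2=-R^2\}$.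 A sphere of codimension two is an $(n-1)$-dimensional cross-section $S^{n-1}$ of a space-like hypersphere with a hyperplane. A canal space-like hypersurface is a space-like hypersurface $M=\{S^{n-1}(s)\}$, $s\in J\subset\mathbb R$, which is a one-parameter family of spheres of codimension two (spherical generators) such that the normals to $M$ at the points of any fixed generator $S^{n-1}(s)$ pass through a fixed point $z(s)$. Its position vector $Z$ then satisfies $(Z-z(s))^2=-R^2(s)$ and $(Z-z(s))\,z'(s)=R(s)R'(s)$, with $R(s)>0$. Such an $M$ is endowed with the induced metric $g$ and the unit tangent vector field $\xi=\frac{t-R'N}{\sqrt{(t-R'N)^2}}$, where $t=z'$ and $N=-\frac{Z-z}{R}$ is the unit normal ($N^2=-1$). It is of parabolic type if the curve of centers $z(s)$ is light-like. *)

(* Defs.v *)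
From HB Require Import structures.
From mathcomp Require Import all_boot all_order all_algebra.
From mathcomp Require Import all_classical all_reals all_analysis.
Set Implicit Arguments.
Unset Strict Implicit.
Unset Printing Implicit Defensive.
Import Order.TTheory GRing.Theory Num.Theory.
Import numFieldNormedType.Exports.
Local Open Scope classical_set_scope.
Local Open Scope ring_scope.

Section Smooth.
Context {R : realType} {V W : normedModType R}.

Fixpoint iterD (f : V -> W) (vs : seq V) : V -> W :=
  if vs is v :: vs' then 'D_v (iterD f vs') else f.

(* C^infinity on an open set U: every iterated directional derivative is
   (Frechet) differentiable at every point of U. *)
Definition smooth_on (U : set V) (f : V -> W) : Prop :=
  forall vs u, U u -> differentiable (iterD f vs) u.

End Smooth.

(* Riemannian geometry of a metric on an open subset of R^n.  Tangent vectors
   are row vectors of components, and [g u] is the Gram matrix of the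
   coordinate fields at [u]. *)
Section LocalRiemann.
Context {R : realType} {n : nat}.
Notation E := 'rV[R]_n.
Implicit Types (g : E -> 'M[R]_n) (u x y z w : E).

Definition gdot (G : 'M[R]_n) x y : R := (x *m G *m y^T) 0 0.

Definition pd (i : 'I_n) (f : E -> R) : E -> R := 'D_(delta_mx 0 i) f.

(* Gamma^k_ij *)
Definition christoffel g (k i j : 'I_n) u : R :=
  2^-1 * \sum_(l < n) invmx (g u) k l *
    (pd i (fun v => g v j l) u + pd j (fun v => g v i l) u
     - pd l (fun v => g v i j) u).

(* (nabla_x Y)(u), for the Levi-Civita connection of g *)
Definition cov g x (Y : E -> E) u : E :=
  'D_x Y u +
  \row_(k < n) \sum_(i < n) \sum_(j < n) christoffel g k i j u * x 0 i * Y u 0 j.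

(* R(X,Y)Z = nabla_X nabla_Y Z - nabla_Y nabla_X Z - nabla_[X,Y] Z, computed by
   extending x, y, z to fields with constant components, so that [X,Y] = 0. *)
Definition curv g x y z u : E :=
  cov g x (cov g y (cst z)) u - cov g y (cov g x (cst z)) u.

Definition curv4 g u x y z w : R := gdot (g u) (curv g x y z u) w.

Definition orthonormal2 (G : 'M[R]_n) x y : Prop :=
  [/\ gdot G x x = 1, gdot G y y = 1 & gdot G x y = 0].

(* Sectional curvature of the plane with orthonormal basis x, y. *)
Definition sectional g u x y : R := curv4 g u x y y x.

(* Angle between a unit vector xi and the plane with orthonormal basis x, y:
   its cosine is the length of the orthogonal projection of xi on the plane. *)
Definition angle_plane (G : 'M[R]_n) (xi x y : E) : R :=
  acos (Num.sqrt (gdot G xi x ^+ 2 + gdot G xi y ^+ 2)).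

Definition pi_tensor (G : 'M[R]_n) x y z w : R :=
  gdot G y z * gdot G x w - gdot G x z * gdot G y w.

Definition Phi_tensor (G : 'M[R]_n) (xi x y z w : E) : R :=
  let eta := gdot G xi in
  gdot G y z * eta x * eta w - gdot G x z * eta y * eta w
  + gdot G x w * eta y * eta z - gdot G y w * eta x * eta z.

End LocalRiemann.

Section Minkowski.
Context {R : realType} {n : nat}.
Notation V := 'rV[R]_n.+1.
Notation E := 'rV[R]_n.
Implicit Types (M : set V) (U : set E) (X : E -> V) (xi : V -> V).

(* Scalar product of signature (n,1); the last coordinate is the time. *)
Definition mink (v w : V) : R :=
  \sum_(i < n) v 0 (widen_ord (leqnSn n) i) * w 0 (widen_ord (leqnSn n) i)
  - v 0 ord_max * w 0 ord_max.

(* X is a smooth regular parametrization of an open part of M: an injective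
   immersion on the open set U which is a homeomorphism onto a relatively open
   subset of M (the last field says that X : U -> M is an open map). *)
Record chart M U X : Prop := Chart {
  chart_open : open U;
  chart_smooth : smooth_on U X;
  chart_in : forall u, U u -> M (X u);
  chart_immersion : forall u v, U u -> 'D_v X u = 0 -> v = 0;
  chart_inj : forall u v, U u -> U v -> X u = X v -> u = v;
  chart_map_open : forall u (A : set E), U u -> nbhs u A ->
    exists2 B : set V, nbhs (X u) B & M `&` B `<=` X @` (A `&` U) }.

Definition hypersurface M : Prop :=
  forall p, M p -> exists U X u, [/\ chart M U X, U u & X u = p].

Definition induced_metric X (u : E) : 'M[R]_n :=
  \matrix_(i < n, j < n) mink ('D_(delta_mx 0 i) X u) ('D_(delta_mx 0 j) X u).

Definition spacelike_hypersurface M : Prop :=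
  hypersurface M /\
  forall U X u v, chart M U X -> U u -> v != 0 ->
    0 < gdot (induced_metric X u) v v.

(* The normal line to M at p. *)
Definition normal_line M (p : V) : set V :=
  [set q | forall U X u v, chart M U X -> U u -> X u = p ->
    mink (q - p) ('D_v X u) = 0].

(* Y is the field of components, in the chart X, of the tangent field xi. *)
Definition components U X xi (Y : E -> E) : Prop :=
  forall u, U u -> 'D_(Y u) X u = xi (X u).

Definition unit_tangent_field M xi : Prop :=
  forall U X, chart M U X ->
    exists Y, [/\ smooth_on U Y, components U X xi Y &
      forall u, U u -> gdot (induced_metric X u) (Y u) (Y u) = 1].

(* M with its induced metric and the field xi has quasi-constant sectional
   curvatures: K p is the sectional curvature at p as a function of the angle
   between the plane and xi. *)
Definition riemannian_QC M xi : Prop :=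
  unit_tangent_field M xi /\
  exists K : V -> R -> R, forall U X Y u x y,
    chart M U X -> components U X xi Y -> U u ->
    orthonormal2 (induced_metric X u) x y ->
    sectional (induced_metric X) u x y
      = K (X u) (angle_plane (induced_metric X u) (Y u) x y).

(* The curvature tensor is a pi + b Phi. *)
Definition QC_curvature M xi (a b : V -> R) : Prop :=
  forall U X Y u x y z w,
    chart M U X -> components U X xi Y -> U u ->
    let G := induced_metric X u in
    curv4 (induced_metric X) u x y z w
      = a (X u) * pi_tensor G x y z w + b (X u) * Phi_tensor G (Y u) x y z w.

(* nabla_x xi = k x for all x orthogonal to xi *)
Definition QC_k M xi (k : V -> R) : Prop :=
  forall U X Y u x,
    chart M U X -> components U X xi Y -> U u ->
    gdot (induced_metric X u) (Y u) x = 0 ->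
    cov (induced_metric X) x Y u = k (X u) *: x.

Definition spacelike_hypersphere (c : V) (r : R) : set V :=
  [set Z | mink (Z - c) (Z - c) = - r ^+ 2].

(* The nondegeneracy of mink allows hyperplanes to be written with a Minkowski
   normal w. *)
Definition hyperplane (w : V) (d : R) : set V := [set Z | mink w Z = d].

(* The hypersphere has normal Z - c at Z, so the last two conditions say that
   the cross-section is nonempty and transversal, hence of dimension n - 1;
   the excluded sections are empty or reduced to one point. *)
Definition codim2_sphere (S : set V) : Prop :=
  exists c r w d,
    [/\ 0 < r, w != 0, S = spacelike_hypersphere c r `&` hyperplane w d,
        S !=set0 & forall Z (l : R), S Z -> Z - c <> l *: w].

Definition generator M (sigma : V -> R) (s : R) : set V :=
  [set p | M p /\ sigma p = s].

(* Canal space-like hypersurface with parameter domain J, curve of centers z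
   and radius function rad.  [sigma p] is the parameter s of the spherical
   generator through p; the generators form a smooth one-parameter family, that
   is, sigma is smooth on M without critical points.  A generator may be any
   part of the sphere containing it, for instance the whole sphere. *)
Record canal_hypersurface M (J : set R) (sigma : V -> R) (z : R -> V)
    (rad : R -> R) : Prop := CanalHypersurface {
  canal_spacelike : spacelike_hypersurface M;
  canal_open : open J;
  canal_param : forall p, M p -> J (sigma p);
  canal_smooth : forall U X, chart M U X -> smooth_on U (sigma \o X);
  canal_regular : forall U X u, chart M U X -> U u ->
    exists v, 'D_v (sigma \o X) u != 0;
  canal_generator : forall s, J s -> generator M sigma s !=set0 /\
    exists2 S, codim2_sphere S & generator M sigma s `<=` S;
  canal_center_smooth : smooth_on J z;
  canal_radius_smooth : smooth_on J rad;
  canal_radius_gt0 : forall s, J s -> 0 < rad s;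
  canal_normals : forall s p, J s -> generator M sigma s p ->
    normal_line M p (z s);
  canal_radius : forall s p, J s -> generator M sigma s p ->
    mink (p - z s) (p - z s) = - rad s ^+ 2 }.

(* z is a light-like curve *)
Definition parabolic_type (J : set R) (z : R -> V) : Prop :=
  forall s, J s -> derive1 z s != 0 /\ mink (derive1 z s) (derive1 z s) = 0.

Definition canal_normal (sigma : V -> R) (z : R -> V) (rad : R -> R) (p : V) : V :=
  - ((rad (sigma p))^-1 *: (p - z (sigma p))).

Definition canal_xi (sigma : V -> R) (z : R -> V) (rad : R -> R) (p : V) : V :=
  let s := sigma p in
  let v := derive1 z s - derive1 rad s *: canal_normal sigma z rad p in
  (Num.sqrt (mink v v))^-1 *: v.

End Minkowski.

(* Main.v *)
Require Import Defs.
From mathcomp Require Import all_boot all_order all_algebra.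
From mathcomp Require Import all_classical all_reals all_analysis.
From mathcomp Require Import ring lra.
Set Implicit Arguments.
Unset Strict Implicit.
Unset Printing Implicit Defensive.
Import Order.TTheory GRing.Theory Num.Theory.
Import numFieldNormedType.Exports.
Local Open Scope classical_set_scope.
Local Open Scope ring_scope.

(** Write [s] for the parameter of the generator through a point [Z] of the
    hypersurface, [r] for the radius, and [P = Z - z(s)], a normal vector with
    [P^2 = - r^2].  Differentiating [P^2 = - r^2] along the hypersurface gives
    [P z' = r r'].  Since [P] is time-like and [z'] is light-like and nonzero,
    [P z'] is not zero, so [r'] never vanishes ([mink_timelike_lightlike],
    [canal_radius_derive_neq0]); moreover [z' - r' N] has length [|r'|], so [xi]
    is a smooth unit field.

    Differentiating [P z' = r r'] once more, the term [z' z'] disappears, and for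
    a tangent vector [x] one finds [x z' = lambda ds(x)] with
    [lambda = r'^2 + r r'' - P z''] ([canal_tangent_center]).  As
    [x xi = x z' / |r'|], the differential [ds] is a multiple of the form [eta]
    dual to [xi], and [lambda] does not vanish.  Differentiating [P x = 0] then
    gives the second fundamental form with respect to [P],

      [P D_y D_w Z = mu eta(y) eta(w) - g(y, w)],  [mu = r'^2 / lambda]

    ([canal_second_form]).  The Gauss equation ([gauss_equation]), with [P^2 = - r^2],
    turns it into a curvature tensor [a pi + b Phi] where [a = - 1 / r^2] and
    [b = mu / r^2] ([canal_QC_curvature]), and such a tensor makes the sectional
    curvature the function [a + b cos^2] of the angle
    ([QC_curvature_riemannian_QC]).  Finally [xi = z' / |r'| + k P] with
    [k = r' / (|r'| r)]; a vector [x] orthogonal to [xi] satisfies [ds(x) = 0],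
    so that [D_x xi = k x] ([canal_QC_k]), and [k^2 = 1 / r^2 = - a].

    The metric is given through its Gram matrix and Christoffel symbols.  The
    connection is therefore first identified with the tangential part of the flat
    derivative ([covE]), which rests on the symmetry of second derivatives
    ([derive_swap]), and its differentiability on the stability of smooth
    functions under the operations that occur ([smooth_exprP]). *)

(** * Local nature of differentiability, derivatives along lines *)

Section Germs.
Context {R : realType} {V W : normedModType R}.
Implicit Types (f g : V -> W) (u v : V).

(** The difference of the two functions vanishes near the point, hence has zero
    differential there. *)
Lemma near_eq_differentiable f g u :
  (\near u, f u = g u) -> differentiable f u -> differentiable g u.
Proof.
move=> fg df.
have e_eq : (g - f) \o shift u = cst ((g - f) u) + 0 +o_ (0 : V) id.
  apply/eqaddoP => _ /posnumP[e]; near=> h.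
  rewrite !fctE /= -(nbhs_singleton fg) subrr addr0 subr0.
  have -> : g (h + u) = f (h + u).
    near: h; move: fg; rewrite (near_shift 0 u) subr0 => fg.
    by near do symmetry.
  by rewrite subrr normr0 mulr_ge0.
have dE : differentiable (g - f) u.
  have d0 : 'd (g - f) u = \0 :> (V -> W).
    by apply/diff_unique; [exact: cst_continuous|exact: e_eq].
  by apply/diff_locallyP; rewrite d0; split; [exact: cst_continuous|exact: e_eq].
have -> : g = f + (g - f) by rewrite addrC subrK.
exact: differentiableD.
Unshelve. all: by end_near. Qed.

Lemma derive_dirZ f u a x : differentiable f u -> 'D_(a *: x) f u = a *: 'D_x f u.
Proof. by move=> df; rewrite !deriveE// linearZ. Qed.

Lemma derive_dirD f u x y : differentiable f u ->
  'D_(x + y) f u = 'D_x f u + 'D_y f u.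
Proof. by move=> df; rewrite !deriveE// linearD. Qed.

Lemma derive_line f u v (t : R) : differentiable f (t *: v + u) ->
  is_derive t 1 (fun s : R => f (s *: v + u)) ('D_v f (t *: v + u)).
Proof.
move=> /(@diff_derivable _ _ _ _ _ v) df.
have E : (fun h : R => h^-1 *: (((fun s => f (s *: v + u)) \o shift t) (h *: 1)
    - f (t *: v + u)))
  = (fun h => h^-1 *: ((f \o shift (t *: v + u)) (h *: v) - f (t *: v + u))).
  apply/funext => h /=; congr (_ *: (f _ - _)).
  by rewrite scalerDl addrA -[h *: 1]/(h * 1) mulr1.
by split; [rewrite /derivable E; exact: df | rewrite /derive E].
Qed.

End Germs.

Section Chain.
Context {R : realType} {V W : normedModType R}.

Lemma derive_comp1 (h : R -> W) (s : V -> R) u v :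
  differentiable s u -> differentiable h (s u) ->
  'D_v (h \o s) u = 'D_v s u *: derive1 h (s u).
Proof.
move=> ds dh; rewrite (deriveE v ds) deriveE; last exact: differentiable_comp.
by rewrite diff_comp//= diff1E.
Qed.

End Chain.

(** * Closure properties of smooth functions *)

Section SmoothBasics.
Context {R : realType} {V W : normedModType R} (U : set V).
Hypothesis oU : open U.
Implicit Types (f g : V -> W) (u v : V).

Lemma derive_eq_on f g v : {in U, f =1 g} -> {in U, 'D_v f =1 'D_v g}.
Proof.
move=> fg u /set_mem Uu; apply: near_eq_derive.
by near=> t; apply/fg/mem_set; near: t; exact: open_nbhs_nbhs.
Unshelve. all: by end_near. Qed.

Lemma iterD_eq_on f g vs : {in U, f =1 g} -> {in U, Defs.iterD f vs =1 Defs.iterD g vs}.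
Proof. by move=> fg; elim: vs => //= v vs; exact: derive_eq_on. Qed.

Lemma differentiable_eq_on f g : {in U, f =1 g} ->
  forall u, U u -> differentiable f u -> differentiable g u.
Proof.
move=> fg u Uu; apply: near_eq_differentiable.
by near=> t; apply/fg/mem_set; near: t; exact: open_nbhs_nbhs.
Unshelve. all: by end_near. Qed.

Lemma smooth_on_eq f g : {in U, f =1 g} -> smooth_on U f -> smooth_on U g.
Proof.
move=> fg sf vs u Uu.
by apply: (differentiable_eq_on (iterD_eq_on vs fg)) (sf _ _ _).
Qed.

Lemma iterD_rcons f vs v : Defs.iterD f (rcons vs v) = Defs.iterD ('D_v f) vs.
Proof. by elim: vs => //= w vs ->. Qed.

Lemma smooth_on_derive f v : smooth_on U f -> smooth_on U ('D_v f).
Proof. by move=> sf vs u Uu; rewrite -iterD_rcons; exact: sf. Qed.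

Lemma smooth_on_diff f : smooth_on U f -> forall u, U u -> differentiable f u.
Proof. by move=> sf u; exact: (sf [::]). Qed.

(** Smoothness is the largest property of functions that implies
    differentiability on [U] and is inherited, up to equality on [U], by all
    directional derivatives.  Every closure property below is obtained by
    exhibiting a class of functions stable under derivation. *)
Lemma smooth_on_coind (C : set (V -> W)) :
  (forall f, C f -> (forall u, U u -> differentiable f u) /\
    forall v, exists2 g, C g & {in U, 'D_v f =1 g}) ->
  forall f, C f -> smooth_on U f.
Proof.
move=> HC f Cf vs; elim/last_ind: vs f Cf => [|vs v IH] f Cf u Uu.
  exact: (HC _ Cf).1.
rewrite iterD_rcons; have [g Cg fg] := (HC _ Cf).2 v.
apply: (@differentiable_eq_on (Defs.iterD g vs)) => //; last exact: IH.
by move=> t Ut; symmetry; exact: iterD_eq_on.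
Qed.

Lemma smooth_on_cst (c : W) : smooth_on U (cst c).
Proof.
apply: (@smooth_on_coind (range cst)) => // f [d _ <-]; split=> [u _|v].
  exact: differentiable_cst.
by exists (cst 0) => // u _; rewrite derive_cst.
Qed.

End SmoothBasics.

Section SmoothReal.
Context {R : realType} {V : normedModType R} (U : set V).
Hypothesis oU : open U.
Implicit Types (f g : V -> R).

(** The Leibniz, quotient and chain rules express the derivative of such an
    expression by the expression itself and derivatives of its parts.  The
    operations have to be treated together, since the derivative of a product,
    for instance, is a sum. *)
Inductive smooth_expr : (V -> R) -> Prop :=
| ExprBase f of smooth_on U f : smooth_expr f
| ExprAdd f g of smooth_expr f & smooth_expr g : smooth_expr (f + g)
| ExprMul f g of smooth_expr f & smooth_expr g : smooth_expr (f * g)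
| ExprInv f of smooth_expr f & (forall u, U u -> f u != 0) :
    smooth_expr (fun u => (f u)^-1)
| ExprSqrt f of smooth_expr f & (forall u, U u -> 0 < f u) :
    smooth_expr (fun u => Num.sqrt (f u))
| ExprComp (J : set R) (h : R -> R) s of smooth_on J h & smooth_expr s &
    (forall u, U u -> J (s u)) : smooth_expr (h \o s).

Lemma smooth_exprP f : smooth_expr f -> smooth_on U f.
Proof.
apply: smooth_on_coind => // {}f.
elim=> {f} [f sf|f g _ [df f'] _ [dg g']|f g ef [df f'] eg [dg g']
  |f ef [df f'] f0|f ef [df f'] f0|J h s sh es [ds s'] sJ]; split=> [u Uu|v].
- exact: smooth_on_diff sf _ Uu.
- by exists ('D_v f) => //; apply/ExprBase/smooth_on_derive.
- by apply: differentiableD; [exact: df|exact: dg].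
- have [df1 e1 E1] := f' v; have [dg1 e2 E2] := g' v.
  exists (df1 + dg1); first exact: ExprAdd.
  move=> u uU; have Uu := set_mem uU.
  by rewrite deriveD ?E1 ?E2//; apply: diff_derivable; [exact: df|exact: dg].
- by apply: differentiableM; [exact: df|exact: dg].
- have [df1 e1 E1] := f' v; have [dg1 e2 E2] := g' v.
  exists (f * dg1 + g * df1); first by apply: ExprAdd; exact: ExprMul.
  move=> u uU; have Uu := set_mem uU.
  by rewrite deriveM ?E1 ?E2//; apply: diff_derivable; [exact: df|exact: dg].
- by apply: differentiableV; [exact: df|exact: f0].
- have [df1 e1 E1] := f' v.
  exists (cst (-1) * ((fun u => (f u)^-1) * (fun u => (f u)^-1)) * df1).
    apply: ExprMul => //; apply: ExprMul; last by apply: ExprMul; exact: ExprInv.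
    exact/ExprBase/smooth_on_cst.
  move=> u uU; have Uu := set_mem uU.
  rewrite deriveV ?E1 ?f0//; last exact/diff_derivable/df.
  rewrite -[RHS]/(-1 * ((f u)^-1 * (f u)^-1) * df1 u).
  by rewrite -[LHS]/(- (f u ^+ 2)^-1 * df1 u) expr2 invfM mulN1r.
- apply: (@differentiable_comp _ _ _ _ f Num.sqrt); first exact: df.
  by apply/derivable1_diffP; apply: ex_derive; apply: is_derive1_sqrt; exact: f0.
- have [df1 e1 E1] := f' v.
  exists ((fun u => ((cst 2 * (fun u => Num.sqrt (f u))) u)^-1) * df1).
    apply: ExprMul => //; apply: ExprInv.
      by apply: ExprMul; [exact/ExprBase/smooth_on_cst|exact: ExprSqrt].
    by move=> u Uu; rewrite mulf_neq0// gt_eqF// sqrtr_gt0 f0.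
  move=> u uU; have Uu := set_mem uU.
  have S := is_derive1_sqrt (f0 _ Uu).
  rewrite (@derive_comp1 _ _ _ Num.sqrt f) ?E1//; last 2 first.
  + exact: df.
  + by apply/derivable1_diffP; exact: ex_derive.
  by rewrite derive1E derive_val -[_ *: _]/(_ * _) mulrC.
- by apply: differentiable_comp; [exact: ds|exact/(smooth_on_diff sh)/sJ].
- have [ds1 e1 E1] := s' v; exists (ds1 * (derive1 h \o s)).
    apply: ExprMul => //; apply: (@ExprComp J) => //.
    have -> : derive1 h = 'D_1 h by apply/funext => t; rewrite derive1E.
    exact: smooth_on_derive.
  move=> u uU; have Uu := set_mem uU.
  rewrite derive_comp1 ?E1//; first exact: ds.
  exact/(smooth_on_diff sh)/sJ.
Qed.

Lemma smooth_on_add f g : smooth_on U f -> smooth_on U g -> smooth_on U (f + g).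
Proof. by move=> sf sg; apply/smooth_exprP/ExprAdd; exact: ExprBase. Qed.

Lemma smooth_on_mul f g : smooth_on U f -> smooth_on U g -> smooth_on U (f * g).
Proof. by move=> sf sg; apply/smooth_exprP/ExprMul; exact: ExprBase. Qed.

Lemma smooth_on_inv f : smooth_on U f -> (forall u, U u -> f u != 0) ->
  smooth_on U (fun u => (f u)^-1).
Proof. by move=> sf f0; apply/smooth_exprP/ExprInv => //; exact: ExprBase. Qed.

Lemma smooth_on_sqrt f : smooth_on U f -> (forall u, U u -> 0 < f u) ->
  smooth_on U (fun u => Num.sqrt (f u)).
Proof. by move=> sf f0; apply/smooth_exprP/ExprSqrt => //; exact: ExprBase. Qed.

Lemma smooth_on_comp (J : set R) (h : R -> R) s : smooth_on J h ->
  smooth_on U s -> (forall u, U u -> J (s u)) -> smooth_on U (h \o s).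
Proof.
by move=> sh ss sJ; apply/smooth_exprP/(ExprComp sh) => //; exact: ExprBase.
Qed.

Lemma smooth_on_sum (I : Type) (r : seq I) (P : pred I) (F : I -> V -> R) :
  (forall i, P i -> smooth_on U (F i)) ->
  smooth_on U (fun u => \sum_(i <- r | P i) F i u).
Proof.
move=> sF; have -> : (fun u => \sum_(i <- r | P i) F i u) = \sum_(i <- r | P i) F i.
  by apply/funext => u; rewrite fct_sumE.
by elim/big_ind: _ => //; [exact: smooth_on_cst|exact: smooth_on_add].
Qed.

Lemma smooth_on_prod (I : Type) (r : seq I) (P : pred I) (F : I -> V -> R) :
  (forall i, P i -> smooth_on U (F i)) ->
  smooth_on U (fun u => \prod_(i <- r | P i) F i u).
Proof.
move=> sF; have -> : (fun u => \prod_(i <- r | P i) F i u) = \prod_(i <- r | P i) F i.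
  by apply/funext => u; rewrite fct_prodE.
by elim/big_ind: _ => //; [exact: smooth_on_cst|exact: smooth_on_mul].
Qed.

End SmoothReal.

(** * Symmetry of second derivatives *)

Section MixedPartials.
Context {R : realType} {V : normedModType R} (U : set V).
Hypothesis oU : open U.
Implicit Types (f : V -> R) (u v x y : V).

(** The mean value theorem is applied to [s |-> f (s x + h y + u) - f (s x + u)],
    and then to the derivative [D_x f] along [y]. *)
Lemma second_difference f u x y (h : R) : smooth_on U f -> 0 < h ->
  (forall s t, 0 <= s <= h -> 0 <= t <= h -> U (s *: x + t *: y + u)) ->
  exists s t, [/\ 0 <= s <= h, 0 <= t <= h &
    f (h *: x + h *: y + u) - f (h *: x + u) - (f (h *: y + u) - f u)
      = 'D_y ('D_x f) (s *: x + t *: y + u) * h * h].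
Proof.
move=> sf h0 hU.
have hh : 0 <= h <= h by rewrite ltW//=.
have h00 : (0 : R) <= 0 <= h by rewrite lexx ltW.
pose g (s : R) := f (s *: x + (h *: y + u)) - f (s *: x + u).
pose dg (s : R) := 'D_x f (s *: x + (h *: y + u)) - 'D_x f (s *: x + u).
have gD s : 0 <= s <= h -> is_derive s 1 g (dg s).
  move=> sh; apply: is_deriveB; apply: derive_line; apply: (smooth_on_diff sf).
    by rewrite addrA; exact: hU.
  by have := hU s 0 sh h00; rewrite scale0r addr0.
have [] := @MVT_segment R g dg 0 h (ltW h0).
- by move=> s /[!in_itv]/= /andP[s0 sh]; apply: gD; rewrite !ltW.
- apply: derivable_within_continuous => s /[!in_itv]/= sh.
  by have := gD s sh => -[].
move=> s /[!in_itv]/= sh; rewrite subr0 => gE.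
pose k (t : R) := 'D_x f (t *: y + (s *: x + u)).
pose dk (t : R) := 'D_y ('D_x f) (t *: y + (s *: x + u)).
have kD t : 0 <= t <= h -> is_derive t 1 k (dk t).
  move=> th; apply: derive_line; apply: (smooth_on_diff (smooth_on_derive x sf)).
  by rewrite addrCA addrA; exact: hU.
have [] := @MVT_segment R k dk 0 h (ltW h0).
- by move=> t /[!in_itv]/= /andP[t0 th]; apply: kD; rewrite !ltW.
- apply: derivable_within_continuous => t /[!in_itv]/= th.
  by have := kD t th => -[].
move=> t /[!in_itv]/= th; rewrite subr0 => kE.
exists s, t; split=> //.
have -> : s *: x + t *: y + u = t *: y + (s *: x + u) by rewrite addrCA addrA.
rewrite -[X in X * h * h]/(dk t) -kE.
have -> : k h - k 0 = dg s by rewrite /k /dg scale0r add0r addrCA.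
by rewrite -gE /g !scale0r !add0r addrA.
Qed.

Lemma half_dist_contra (a b p q : R) : `|a - p| < `|a - b| / 2 ->
  `|b - q| < `|a - b| / 2 -> q = p -> False.
Proof.
move=> ap bq qp; move: (ltrD ap bq); rewrite qp -splitr (distrC b) ltNge.
by rewrite -{1}(subrKA p a) ler_normD.
Qed.

(** The second difference of [f] is symmetric in [x] and [y]; dividing it by
    [h ^+ 2] gives values of both mixed derivatives at points that tend to [u]
    with [h], and these derivatives are continuous at [u]. *)
Lemma derive_swap f u x y : smooth_on U f -> U u ->
  'D_x ('D_y f) u = 'D_y ('D_x f) u.
Proof.
move=> sf Uu; apply/eqP; rewrite -subr_eq0; apply/negPn/negP => d0.
set d := _ - _ in d0; pose e := `|d| / 2.
have e0 : 0 < e by rewrite divr_gt0 ?normr_gt0.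
have cxy := differentiable_continuous (smooth_on_diff (smooth_on_derive x (smooth_on_derive y sf)) Uu).
have cyx := differentiable_continuous (smooth_on_diff (smooth_on_derive y (smooth_on_derive x sf)) Uu).
have nU : nbhs u U by exact: open_nbhs_nbhs.
move/cvgrPdist_lt : cxy => /(_ e e0) cxy.
move/cvgrPdist_lt : cyx => /(_ e e0) cyx.
have [r /= r0 hr] := (nbhs_ballP _ _).1 (filterI nU (filterI cxy cyx)).
(* The parallelogram spanned by [h *: x] and [h *: y] lies in the ball of
   radius [r]. *)
pose N := `|x| + `|y| + 1; pose h := r / 2 / N.
have N0 : 0 < N by rewrite ltr_wpDl// addr_ge0.
have h0 : 0 < h by rewrite !divr_gt0.
have near_u a b : 0 <= a <= h -> 0 <= b <= h -> ball u r (a *: x + b *: y + u).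
  move=> /andP[a0 ah] /andP[b0 bh]; rewrite -ball_normE /ball_/= opprD addrCA subrr addr0.
  rewrite normrN (le_lt_trans (ler_normD _ _))// !normrZ !ger0_norm//.
  have : a * `|x| + b * `|y| <= h * (`|x| + `|y|).
    by rewrite mulrDr lerD// ler_wpM2r.
  move=> /le_lt_trans; apply; apply: (@lt_trans _ _ (h * N)).
    by rewrite ltr_pM2l// /N ltrDl.
  by rewrite /h divfK ?gt_eqF// ltr_pdivrMr// ltr_pMr// ltr1n.
have near_u' a b : 0 <= a <= h -> 0 <= b <= h -> ball u r (a *: y + b *: x + u).
  by move=> ah bh; rewrite [X in X + u]addrC; exact: near_u.
have [s [t [sh th E1]]] : exists s t, [/\ 0 <= s <= h, 0 <= t <= h & _] :=
  second_difference sf h0 (fun s t sh th => (hr _ (near_u s t sh th)).1).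
have [s' [t' [sh' th' E2]]] : exists s t, [/\ 0 <= s <= h, 0 <= t <= h & _] :=
  second_difference sf h0 (fun s t sh th => (hr _ (near_u' s t sh th)).1).
have [_ [_ /= B1]] := hr _ (near_u _ _ sh th).
have [_ [/= B2 _]] := hr _ (near_u' _ _ sh' th').
have E : 'D_y ('D_x f) (s *: x + t *: y + u) = 'D_x ('D_y f) (s' *: y + t' *: x + u).
  apply: (mulIf (lt0r_neq0 h0)); apply: (mulIf (lt0r_neq0 h0)).
  apply: etrans (esym E1) (etrans _ E2); rewrite (addrC (h *: y) (h *: x)).
  have aux (p q k l : R) : p - q - (k - l) = p - k - (q - l) by ring.
  exact: aux.
exact: (half_dist_contra B2 B1 E).
Qed.

End MixedPartials.

(** * Matrix-valued functions *)

Section MatrixFunctions.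
Context {R : realType} {V : normedModType R}.
Implicit Types (U : set V) (u v : V).

Lemma differentiable_mxP m n (F : V -> 'M[R]_(m, n)) u :
  differentiable F u <-> forall i j, differentiable (fun t => F t i j) u.
Proof.
split=> [dF i j|dF].
  exact: (@differentiable_comp _ _ _ _ F (fun A : 'M[R]_(m, n) => A i j)
    u dF (differentiable_coord _ _ _)).
have -> : F = \sum_i \sum_j (fun t => F t i j *: delta_mx i j).
  apply/funext => t; rewrite [LHS]matrix_sum_delta fct_sumE.
  by apply: eq_bigr => i _; rewrite fct_sumE.
apply: differentiable_sum => i; apply: differentiable_sum => j.
exact: differentiableZl.
Qed.

Lemma derive_coord m n (F : V -> 'M[R]_(m, n)) u v i j : differentiable F u ->
  'D_v F u i j = 'D_v (fun t => F t i j) u.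
Proof. by move=> dF; rewrite (derive_mx (diff_derivable dF)) mxE. Qed.

Lemma smooth_on_mxP U m n (F : V -> 'M[R]_(m, n)) : open U ->
  smooth_on U F <-> forall i j, smooth_on U (fun t => F t i j).
Proof.
move=> oU; split=> [sF i j|].
  apply: (@smooth_on_coind _ _ _ _ oU [set f | exists2 F : V -> 'M[R]_(m, n),
    smooth_on U F & f = fun t => F t i j]); last by exists F.
  move=> _ [G sG ->]; split=> [u Uu|v].
    exact: ((differentiable_mxP _ _).1 (smooth_on_diff sG Uu)).
  exists (fun t => 'D_v G t i j); first by exists ('D_v G) => //; exact: smooth_on_derive.
  by move=> u /set_mem Uu; rewrite derive_coord//; exact: smooth_on_diff sG _ Uu.
move=> H; apply: (@smooth_on_coind _ _ _ _ oU
  [set F : V -> 'M[R]_(m, n) | forall i j, smooth_on U (fun t => F t i j)]) => // {H}{}F sF.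
have dF u : U u -> differentiable F u.
  by move=> Uu; apply/differentiable_mxP => i j; exact: smooth_on_diff (sF i j) _ Uu.
split=> // v; exists ('D_v F) => // i j.
apply: (@smooth_on_eq _ _ _ _ oU ('D_v (fun t => F t i j))).
  by move=> u /set_mem Uu; rewrite derive_coord//; exact: dF.
exact: smooth_on_derive.
Qed.

Lemma smooth_on_det U n (F : V -> 'M[R]_n) : open U ->
  (forall i j, smooth_on U (fun t => F t i j)) -> smooth_on U (fun t => \det (F t)).
Proof.
move=> oU sF; apply: smooth_on_sum => // s _; apply: smooth_on_mul => //.
  exact: smooth_on_cst.
by apply: smooth_on_prod.
Qed.

(** By Cramer's rule the entries of the inverse are quotients of determinants. *)
Lemma smooth_on_invmx U n (F : V -> 'M[R]_n) : open U -> smooth_on U F ->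
  (forall u, U u -> F u \in unitmx) -> smooth_on U (fun t => invmx (F t)).
Proof.
move=> oU /(smooth_on_mxP _ oU) sF Fu; apply/(smooth_on_mxP _ oU) => i j.
apply: (@smooth_on_eq _ _ _ _ oU
  ((fun t => (\det (F t))^-1) * (fun t => cofactor (F t) j i))).
  by move=> u /set_mem Uu; rewrite /invmx Fu// !mxE.
apply: smooth_on_mul => //.
  apply: smooth_on_inv => //; first exact: smooth_on_det.
  by move=> u /Fu; rewrite unitmxE unitfE.
apply: smooth_on_mul => //; first exact: smooth_on_cst.
apply: smooth_on_det => // k l.
by apply: smooth_on_eq (sF (lift j k) (lift i l)) => // u _; rewrite !mxE.
Qed.

Lemma derive_swap_mx U m n (F : V -> 'M[R]_(m, n)) u x y : open U ->
  smooth_on U F -> U u -> 'D_x ('D_y F) u = 'D_y ('D_x F) u.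
Proof.
move=> oU sF Uu; apply/matrixP => i j.
have D w w' : 'D_w ('D_w' F) u i j = 'D_w ('D_w' (fun t => F t i j)) u.
  rewrite derive_coord; last exact: smooth_on_diff (smooth_on_derive _ sF) _ Uu.
  apply: (derive_eq_on (U := U)) => //; last exact/mem_set.
  by move=> t /set_mem Ut; rewrite derive_coord//; exact: smooth_on_diff sF _ Ut.
apply: etrans (D x y) (etrans _ (esym (D y x))).
exact: (derive_swap oU) ((smooth_on_mxP F oU).1 sF i j) Uu.
Qed.

Lemma derive_scale m n (k : V -> R) (F : V -> 'M[R]_(m, n)) u v :
  differentiable k u -> differentiable F u ->
  differentiable (fun t => k t *: F t) u /\
  'D_v (fun t => k t *: F t) u = 'D_v k u *: F u + k u *: 'D_v F u.
Proof.
move=> dk dF; have dkF : differentiable (fun t => k t *: F t) u.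
  apply/differentiable_mxP => i j.
  have -> : (fun t => (k t *: F t) i j) = k * (fun t => F t i j).
    by apply/funext => t; rewrite mxE.
  by apply: differentiableM => //; exact: ((differentiable_mxP F u).1 dF).
split=> //; apply/matrixP => i j.
rewrite derive_coord// !mxE derive_coord//.
have -> : (fun t => (k t *: F t) i j) = k * (fun t => F t i j).
  by apply/funext => t; rewrite mxE.
rewrite deriveM; first by rewrite addrC; congr (_ + _); exact: mulrC.
  exact: diff_derivable.
exact/diff_derivable/((differentiable_mxP F u).1 dF).
Qed.

Lemma smooth_on_addmx U m n (F H : V -> 'M[R]_(m, n)) : open U ->
  smooth_on U F -> smooth_on U H -> smooth_on U (fun t => F t + H t).
Proof.
move=> oU /(smooth_on_mxP _ oU) sF /(smooth_on_mxP _ oU) sH.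
apply/(smooth_on_mxP _ oU) => i j.
have -> : (fun t => (F t + H t) i j) = (fun t => F t i j) + (fun t => H t i j).
  by apply/funext => t; rewrite mxE.
exact: smooth_on_add.
Qed.

Lemma smooth_on_scalemx U m n (k : V -> R) (F : V -> 'M[R]_(m, n)) : open U ->
  smooth_on U k -> smooth_on U F -> smooth_on U (fun t => k t *: F t).
Proof.
move=> oU sk /(smooth_on_mxP _ oU) sF; apply/(smooth_on_mxP _ oU) => i j.
have -> : (fun t => (k t *: F t) i j) = k * (fun t => F t i j).
  by apply/funext => t; rewrite mxE.
exact: smooth_on_mul.
Qed.

End MatrixFunctions.

Lemma smooth_on_compmx {R : realType} {V : normedModType R} (U : set V)
    (J : set R) m n (h : R -> 'M[R]_(m, n)) (s : V -> R) :
  open U -> open J -> smooth_on J h -> smooth_on U s ->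
  (forall u, U u -> J (s u)) -> smooth_on U (fun t => h (s t)).
Proof.
move=> oU oJ /(smooth_on_mxP _ oJ) sh ss sJ; apply/(smooth_on_mxP _ oU) => i j.
exact: (smooth_on_comp oU (sh i j) ss sJ).
Qed.

Section MovingDirection.
Context {R : realType} {n : nat}.
Notation E := 'rV[R]_n.

Lemma derive_row_sum m (X : E -> 'rV[R]_m) u v : differentiable X u ->
  'D_v X u = \sum_i v 0 i *: 'D_(delta_mx 0 i) X u.
Proof.
move=> dX; rewrite deriveE// {1}(row_sum_delta v) linear_sum.
by apply: eq_bigr => i _; rewrite linearZ/= deriveE.
Qed.

(** Product rule for the bilinear pairing of a direction field [B] with the
    differential of [X]. *)
Lemma derive_moving m (U : set E) (X : E -> 'rV[R]_m) (B : E -> E) u x :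
  open U -> smooth_on U X -> U u -> differentiable B u ->
  differentiable (fun t => 'D_(B t) X t) u /\
  'D_x (fun t => 'D_(B t) X t) u = 'D_x ('D_(B u) X) u + 'D_('D_x B u) X u.
Proof.
move=> oU sX Uu dB.
pose S t := \sum_i B t 0 i *: 'D_(delta_mx 0 i) X t.
have SE : {in U, S =1 (fun t => 'D_(B t) X t)}.
  by move=> t /set_mem Ut; rewrite derive_row_sum//; exact: smooth_on_diff sX _ Ut.
have ST : S = \sum_i (fun t => B t 0 i *: 'D_(delta_mx 0 i) X t).
  by apply/funext => t; rewrite fct_sumE.
have dBi i : differentiable (fun t => B t 0 i) u by exact: ((differentiable_mxP B u).1 dB).
have dXi i : differentiable ('D_(delta_mx 0 i) X) u.
  exact: smooth_on_diff (smooth_on_derive _ sX) _ Uu.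
have dS i : differentiable (fun t => B t 0 i *: 'D_(delta_mx 0 i) X t) u.
  exact: (derive_scale 0 (dBi i) (dXi i)).1.
have dSS : differentiable S u by rewrite ST; exact: differentiable_sum.
split; first exact: (differentiable_eq_on oU SE) dSS.
rewrite -(derive_eq_on oU _ SE); last exact/mem_set.
rewrite ST derive_sum; last by move=> i; exact: diff_derivable.
rewrite [RHS]addrC (derive_row_sum ('D_x B u)); last exact: smooth_on_diff sX _ Uu.
have -> : 'D_x ('D_(B u) X) u = \sum_i B u 0 i *: 'D_x ('D_(delta_mx 0 i) X) u.
  pose S' := \sum_i (B u 0 i \*: 'D_(delta_mx 0 i) X).
  have S'E : {in U, S' =1 'D_(B u) X}.
    move=> t /set_mem Ut; rewrite derive_row_sum; first by rewrite /S' fct_sumE.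
    exact: smooth_on_diff sX _ Ut.
  rewrite -(derive_eq_on oU _ S'E); last exact/mem_set.
  rewrite derive_sum; last by move=> i; apply/derivableZ/diff_derivable.
  by apply: eq_bigr => i _; rewrite deriveZ//; exact: diff_derivable.
rewrite -big_split/=; apply: eq_bigr => i _.
by rewrite (derive_scale x (dBi i) (dXi i)).2 derive_coord.
Qed.

End MovingDirection.

(** * The Minkowski scalar product *)

Section MinkAlgebra.
Context {R : realType} {n : nat}.
Notation V := 'rV[R]_n.+1.
Implicit Types u v w : V.

Definition mink_sign (i : 'I_n.+1) : R := (-1) ^+ (i == ord_max).

Lemma minkE v w : mink v w = \sum_i mink_sign i * (v 0 i * w 0 i).
Proof.
rewrite /mink big_ord_recr /mink_sign eqxx expr1 mulN1r; congr (_ - _).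
apply: eq_bigr => i _; rewrite (_ : (_ == _) = false) ?expr0 ?mul1r//.
by rewrite -val_eqE /= ltn_eqF.
Qed.

Lemma minkC v w : mink v w = mink w v.
Proof. by rewrite !minkE; apply: eq_bigr => i _; rewrite [v 0 i * _]mulrC. Qed.

Lemma mink_linear w (a : R) u v : mink (a *: u + v) w = a * mink u w + mink v w.
Proof.
rewrite !minkE mulr_sumr -big_split; apply: eq_bigr => i _ /=; rewrite !mxE; ring.
Qed.

Lemma mink0l w : mink 0 w = 0.
Proof. by have := mink_linear w 1 0 0; rewrite scaler0 addr0 mul1r; lra. Qed.

Lemma minkDl u v w : mink (u + v) w = mink u w + mink v w.
Proof. by have := mink_linear w 1 u v; rewrite scale1r mul1r. Qed.

Lemma minkZl a v w : mink (a *: v) w = a * mink v w.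
Proof. by have := mink_linear w a v 0; rewrite mink0l !addr0. Qed.

Lemma minkNl v w : mink (- v) w = - mink v w.
Proof. by rewrite -scaleN1r minkZl mulN1r. Qed.

Lemma minkBl u v w : mink (u - v) w = mink u w - mink v w.
Proof. by rewrite minkDl minkNl. Qed.

Lemma minkDr w u v : mink w (u + v) = mink w u + mink w v.
Proof. by rewrite minkC minkDl 2!(minkC w). Qed.

Lemma minkZr w a v : mink w (a *: v) = a * mink w v.
Proof. by rewrite minkC minkZl (minkC w). Qed.

Lemma minkNr w v : mink w (- v) = - mink w v.
Proof. by rewrite minkC minkNl (minkC w). Qed.

Lemma minkBr w u v : mink w (u - v) = mink w u - mink w v.
Proof. by rewrite minkDr minkNr. Qed.

Lemma mink_suml (I : finType) (F : I -> V) w :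
  mink (\sum_i F i) w = \sum_i mink (F i) w.
Proof.
exact: (big_morph (fun v : V => mink v w) (fun u v => minkDl u v w) (mink0l w)).
Qed.

Lemma mink_sumr (I : finType) w (F : I -> V) :
  mink w (\sum_i F i) = \sum_i mink w (F i).
Proof. by rewrite minkC mink_suml; apply: eq_bigr => i _; rewrite minkC. Qed.

(** Column of the linear form [mink ^~ w]. *)
Definition minkcol w : 'cV[R]_n.+1 := \col_i (mink_sign i * w 0 i).

Lemma mulmx_minkcol m (A : 'M[R]_(m, n.+1)) w i :
  (A *m minkcol w) i 0 = mink (row i A) w.
Proof. by rewrite minkE mxE; apply: eq_bigr => j _; rewrite !mxE mulrCA. Qed.

(** [p 0 ord_max *: t - t 0 ord_max *: p] has no time component, so its square is
    nonnegative; that square is also [mink p p * t 0 ord_max ^+ 2], which forces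
    the time component of [t] to vanish, and a light-like vector without time
    component is zero. *)
Lemma mink_timelike_lightlike (p t : V) : mink p p < 0 -> mink t t = 0 ->
  mink p t = 0 -> t = 0.
Proof.
move=> pp tt pt.
have space (v : V) : v 0 ord_max = 0 ->
    mink v v = \sum_(i < n) v 0 (widen_ord (leqnSn n) i) ^+ 2.
  by move=> v0; rewrite /mink v0 mulr0 subr0; apply: eq_bigr => i _; rewrite expr2.
have t0 : t 0 ord_max = 0.
  pose w := p 0 ord_max *: t - t 0 ord_max *: p.
  have := space w; rewrite !mxE mulrC subrr => /(_ erefl) ww.
  have : 0 <= mink w w by rewrite ww sumr_ge0// => i _; exact: sqr_ge0.
  have -> : mink w w = mink p p * t 0 ord_max ^+ 2.
    by rewrite !(minkBl, minkBr, minkZl, minkZr) (minkC t p) tt pt; ring.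
  rewrite nmulr_rge0// => tp.
  by apply/eqP; rewrite -sqrf_eq0; apply/eqP/le_anti; rewrite tp sqr_ge0.
apply/rowP => i; rewrite mxE; have := space _ t0; rewrite tt => /esym/psumr_eq0P H.
case: (unliftP ord_max i) => [j ->|->//].
have /eqP := H (fun i _ => sqr_ge0 _) j isT; rewrite sqrf_eq0 => /eqP <-.
by congr (t _ _); apply/val_inj; rewrite /= /bump leqNgt ltn_ord.
Qed.

Section MinkDerivative.
Context {W : normedModType R}.
Implicit Types F G : W -> V.

Lemma mink_fctE F G : (fun t => mink (F t) (G t)) =
  \sum_i (cst (mink_sign i) * ((fun t => F t 0 i) * (fun t => G t 0 i))).
Proof. by apply/funext => t; rewrite minkE fct_sumE. Qed.

Lemma derive_mink F G (u v : W) : differentiable F u -> differentiable G u ->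
  'D_v (fun t => mink (F t) (G t)) u = mink ('D_v F u) (G u) + mink (F u) ('D_v G u).
Proof.
move=> dF dG; have cF := (differentiable_mxP F u).1 dF.
have cG := (differentiable_mxP G u).1 dG.
have dFG i : derivable ((fun t => F t 0 i) * (fun t => G t 0 i)) u v.
  exact/diff_derivable/differentiableM.
rewrite mink_fctE derive_sum; last by move=> i; apply: derivableM.
rewrite !minkE -big_split; apply: eq_bigr => i _ /=.
rewrite deriveM// derive_cst scaler0 addr0 deriveM; [|exact: diff_derivable..].
rewrite !derive_coord// -mulrDr addrC; congr (_ * _); congr (_ + _).
by rewrite mulrC.
Qed.

Lemma smooth_on_mink (U : set W) F G : open U -> smooth_on U F -> smooth_on U G ->
  smooth_on U (fun t => mink (F t) (G t)).
Proof.
move=> oU /(smooth_on_mxP _ oU) sF /(smooth_on_mxP _ oU) sG.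
have -> : (fun t => mink (F t) (G t)) =
    (fun t => \sum_i (cst (mink_sign i) * ((fun t => F t 0 i) * (fun t => G t 0 i))) t).
  by rewrite mink_fctE; apply/funext => t; rewrite fct_sumE.
apply: smooth_on_sum => // i _; apply: smooth_on_mul => //.
  exact: smooth_on_cst.
exact: smooth_on_mul.
Qed.

End MinkDerivative.
End MinkAlgebra.

(** * Space-like immersions and the Gauss equation *)

Lemma induced_metricE {R : realType} {n : nat} (X : 'rV[R]_n -> 'rV[R]_n.+1) u i j :
  induced_metric X u i j =
  mink ('D_(delta_mx 0 i) X u) ('D_(delta_mx 0 j) X u).
Proof. by rewrite mxE. Qed.

(** The algebra behind the Christoffel symbols of an induced metric: [T] stands
    for the coordinate tangent vectors and [S] for the second derivatives of the
    position vector, and the three groups are the derivatives of the metric. *)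
Lemma koszul_sum {R : realType} {n : nat} (I : Type) (T : I -> 'rV[R]_n.+1)
    (i j l : I) (S : I -> I -> 'rV[R]_n.+1) : (forall a b, S a b = S b a) ->
  2^-1 * (mink (S i j) (T l) + mink (T j) (S i l) +
          (mink (S j i) (T l) + mink (T i) (S j l)) -
          (mink (S l i) (T j) + mink (T i) (S l j))) = mink (S i j) (T l).
Proof.
move=> sw; rewrite (sw j i) (sw l i) (sw l j) (minkC (T j)); lra.
Qed.

(** [q - a] is normal, so only its component along [p] contributes to its product
    with [d]. *)
Lemma normal_correction {R : realType} {n : nat} (a q p d : 'rV[R]_n.+1)
    (alpha beta : R) : mink p p != 0 ->
  alpha + mink a d = beta + mink q d -> mink p a = 0 ->
  q - a = (mink (q - a) p / mink p p) *: p ->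
  alpha = beta + mink p q * mink p d / mink p p.
Proof.
move=> pp E pa qa; have := congr1 (mink d) qa.
rewrite minkBr minkZr minkBl (minkC a p) pa subr0 (minkC d q) (minkC d a).
rewrite (minkC d p) (minkC q p) => qd.
have -> : alpha = beta + (mink q d - mink a d) by lra.
by rewrite qd mulrAC.
Qed.

Section Immersion.
Context {R : realType} {n : nat}.
Notation E := 'rV[R]_n.
Notation V := 'rV[R]_n.+1.
Variables (U : set E) (X : E -> V).
Hypotheses (oU : open U) (sX : smooth_on U X).
Hypothesis posG : forall u v, U u -> v != 0 -> 0 < gdot (induced_metric X u) v v.
Implicit Types (u v x y z w : E) (p q : V).

Notation G := (induced_metric X).
Notation e_ i := (delta_mx 0 i : E).

Lemma immersion_diff u : U u -> differentiable X u.
Proof. by move=> Uu; exact: smooth_on_diff sX _ Uu. Qed.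

Lemma immersion_diffD v u : U u -> differentiable ('D_v X) u.
Proof. by move=> Uu; exact: smooth_on_diff (smooth_on_derive v sX) _ Uu. Qed.

Lemma immersion_diffDD v w u : U u -> differentiable ('D_v ('D_w X)) u.
Proof. by move=> Uu; exact: smooth_on_diff (smooth_on_derive v (smooth_on_derive w sX)) _ Uu. Qed.

Lemma gdot_induced u x y : U u ->
  gdot (G u) x y = mink ('D_x X u) ('D_y X u).
Proof.
move=> Uu; rewrite (derive_row_sum y (immersion_diff Uu)) mink_sumr.
rewrite /gdot mxE; apply: eq_bigr => j _; rewrite minkZr mulrC !mxE; congr (_ * _).
rewrite (derive_row_sum x (immersion_diff Uu)) mink_suml.
by apply: eq_bigr => i _; rewrite minkZl induced_metricE.
Qed.

Lemma gdotD u x y w : U u -> gdot (G u) (x + y) w = gdot (G u) x w + gdot (G u) y w.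
Proof.
by move=> Uu; rewrite !gdot_induced// derive_dirD ?minkDl//; exact: immersion_diff.
Qed.

Lemma gdotB u x y w : U u -> gdot (G u) (x - y) w = gdot (G u) x w - gdot (G u) y w.
Proof.
move=> Uu; rewrite -scaleN1r gdotD// !gdot_induced// derive_dirZ ?minkZl ?mulN1r//.
exact: immersion_diff.
Qed.

Lemma gdotZ u a x w : U u -> gdot (G u) (a *: x) w = a * gdot (G u) x w.
Proof.
by move=> Uu; rewrite !gdot_induced// derive_dirZ ?minkZl//; exact: immersion_diff.
Qed.

Lemma gdotC u x y : U u -> gdot (G u) x y = gdot (G u) y x.
Proof.
move=> Uu; apply: etrans (gdot_induced x y Uu) _.
exact: etrans (minkC _ _) (esym (gdot_induced y x Uu)).
Qed.

Lemma gdot_eq0 u x : U u -> gdot (G u) x x = 0 -> x = 0.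
Proof.
move=> Uu xx; apply/eqP/negPn/negP => x0.
by have := posG Uu x0; rewrite xx ltxx.
Qed.

Lemma gdot_inj u x y : U u -> (forall w, gdot (G u) x w = gdot (G u) y w) -> x = y.
Proof.
move=> Uu xy; apply/eqP; rewrite -subr_eq0; apply/eqP/(gdot_eq0 Uu).
by rewrite gdotB// xy subrr.
Qed.

Lemma induced_unit u : U u -> G u \in unitmx.
Proof.
move=> Uu; rewrite -row_free_unit; apply: inj_row_free => v vG.
by apply: (gdot_eq0 Uu); rewrite /gdot vG mul0mx mxE.
Qed.

Lemma induced_sym u : (G u)^T = G u.
Proof. by apply/matrixP => i j; rewrite mxE !induced_metricE; exact: minkC. Qed.

(** The tangent vector whose image under the differential of [X] is the orthogonal
    projection of [q] on the tangent space. *)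
Definition sharp u q : E := (\row_l mink q ('D_(e_ l) X u)) *m invmx (G u).

Lemma gdot_sharp u q w : U u -> gdot (G u) (sharp u q) w = mink q ('D_w X u).
Proof.
move=> Uu; rewrite /gdot /sharp mulmxKV ?induced_unit//.
rewrite (derive_row_sum w (immersion_diff Uu)) mink_sumr mxE.
by apply: eq_bigr => l _; rewrite minkZr mulrC !mxE.
Qed.

Lemma smooth_sharp (Q : E -> V) : smooth_on U Q -> smooth_on U (fun u => sharp u (Q u)).
Proof.
move=> sQ; have sG : smooth_on U G.
  apply/(smooth_on_mxP _ oU) => i j.
  have -> : (fun t => G t i j) = (fun t => mink ('D_(e_ i) X t) ('D_(e_ j) X t)).
    by apply/funext => t; rewrite induced_metricE.
  by apply: smooth_on_mink => //; exact: smooth_on_derive.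
have sI := (smooth_on_mxP _ oU).1 (smooth_on_invmx oU sG induced_unit).
apply/(smooth_on_mxP _ oU) => i j.
have -> : (fun t => sharp t (Q t) i j) =
    (fun t => \sum_l ((fun t => mink (Q t) ('D_(e_ l) X t)) *
                      (fun t => invmx (G t) l j)) t).
  by apply/funext => t; rewrite mxE; apply: eq_bigr => l _; rewrite mxE.
apply: smooth_on_sum => // l _; apply: smooth_on_mul => //.
by apply: smooth_on_mink => //; exact: smooth_on_derive.
Qed.

Lemma christoffelE k i j u : U u -> christoffel G k i j u =
  \sum_l invmx (G u) k l * mink ('D_(e_ i) ('D_(e_ j) X) u) ('D_(e_ l) X u).
Proof.
move=> Uu; rewrite /christoffel mulr_sumr; apply: eq_bigr => l _.
rewrite mulrCA; congr (_ * _).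
have pdE a b c : pd a (fun v => G v b c) u =
    mink ('D_(e_ a) ('D_(e_ b) X) u) ('D_(e_ c) X u) +
    mink ('D_(e_ b) X u) ('D_(e_ a) ('D_(e_ c) X) u).
  rewrite /pd -derive_mink; [|exact: immersion_diffD..].
  have -> : (fun v => G v b c) = (fun v => mink ('D_(e_ b) X v) ('D_(e_ c) X v)).
    by apply/funext => t; exact: induced_metricE.
  by [].
have sw a b : 'D_(e_ a) ('D_(e_ b) X) u = 'D_(e_ b) ('D_(e_ a) X) u.
  exact: derive_swap_mx oU sX Uu.
have half_sum (p q r p' q' r' : R) : p = p' -> q = q' -> r = r' ->
  2^-1 * (p + q - r) = 2^-1 * (p' + q' - r') by move=> -> -> ->.
apply: etrans (half_sum _ _ _ _ _ _ (pdE i j l) (pdE j i l) (pdE l i j)) _.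
exact: (koszul_sum (fun a => 'D_(e_ a) X u) i j l sw).
Qed.

Lemma derive2_sum u x y : U u -> 'D_x ('D_y X) u =
  \sum_i \sum_j (x 0 i * y 0 j) *: 'D_(e_ i) ('D_(e_ j) X) u.
Proof.
move=> Uu; apply: etrans (derive_row_sum x (immersion_diffD y Uu)) _.
apply: eq_bigr => i _.
apply: etrans (congr1 _ (derive_swap_mx (e_ i) y oU sX Uu)) _.
apply: etrans (congr1 _ (derive_row_sum y (immersion_diffD _ Uu))) _.
rewrite scaler_sumr; apply: eq_bigr => j _.
by apply: etrans (congr1 _ (congr1 _ (derive_swap_mx (e_ j) (e_ i) oU sX Uu))) _;
  exact: scalerA.
Qed.

(** The Levi-Civita connection is the tangential part of the flat derivative. *)
Lemma covE x (Y : E -> E) u : U u ->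
  cov G x Y u = 'D_x Y u + sharp u ('D_x ('D_(Y u) X) u).
Proof.
move=> Uu; rewrite /cov; congr (_ + _); apply/rowP => k; rewrite !mxE.
have symI l : invmx (G u) l k = invmx (G u) k l.
  by rewrite -{1}[G u]induced_sym -trmx_inv mxE.
under [RHS]eq_bigr => l _.
  rewrite mxE derive2_sum// mink_suml mulr_suml.
  under eq_bigr => i _.
    rewrite mink_suml mulr_suml.
    under eq_bigr do rewrite minkZl.
    over.
  over.
rewrite [RHS]exchange_big; apply: eq_bigr => i _; rewrite [RHS]exchange_big.
apply: eq_bigr => j _; rewrite christoffelE// -mulrA mulr_suml.
by apply: eq_bigr => l _; rewrite symI; ring.
Qed.

Lemma gdot_cov x (Y : E -> E) u w : U u -> differentiable Y u ->
  gdot (G u) (cov G x Y u) w = mink ('D_x (fun t => 'D_(Y t) X t) u) ('D_w X u).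
Proof.
move=> Uu dY; rewrite covE// gdotD// gdot_sharp// gdot_induced// -minkDl.
by rewrite addrC (derive_moving x oU sX Uu dY).2.
Qed.

Section Normal.
Variables (u : E) (p : V).
Hypotheses (Uu : U u) (pp : mink p p != 0).
Hypothesis pT : forall v, mink p ('D_v X u) = 0.

(** The tangent space lies in the orthogonal hyperplane of [p], and both have
    dimension [n]. *)
Lemma tangentP q : mink q p = 0 -> exists y, 'D_y X u = q.
Proof.
move=> qp; pose A : 'M[R]_(n, n.+1) := \matrix_i 'D_(e_ i) X u.
have AE y : y *m A = 'D_y X u.
  rewrite (derive_row_sum y (immersion_diff Uu)) mulmx_sum_row.
  by apply: eq_bigr => i _; rewrite rowK.
have rA : \rank A = n.
  apply/eqP; apply: inj_row_free => v; rewrite AE => v0.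
  by apply: (gdot_eq0 Uu); rewrite gdot_induced// v0 mink0l.
have rp : \rank (minkcol p) = 1%N.
  apply/eqP; rewrite eqn_leq rank_leq_col lt0n mxrank_eq0.
  apply: contra pp => /eqP p0.
  by have := mulmx_minkcol p p 0; rewrite p0 mulmx0 mxE row_id => <-.
have Ak : (A <= kermx (minkcol p))%MS.
  apply/sub_kermxP/matrixP => i j; rewrite ord1 mulmx_minkcol rowK mxE.
  by rewrite minkC pT.
have := mxrank_leqif_eq Ak; rewrite mxrank_ker rp rA subn1 /= => -[_].
rewrite eqxx => /esym/andP[_ kA].
have : (q <= A)%MS.
  apply: submx_trans kA; apply/sub_kermxP/matrixP => i j.
  by rewrite !ord1 mulmx_minkcol row_id qp mxE.
by move=> /submxP[y ->]; exists y; rewrite AE.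
Qed.

(** The component of [q] orthogonal to [p] is tangent and orthogonal to the
    tangent space, on which the metric is definite. *)
Lemma normalP q : (forall w, mink q ('D_w X u) = 0) ->
  q = (mink q p / mink p p) *: p.
Proof.
move=> qT; apply/eqP; rewrite -subr_eq0; apply/eqP.
set q' := _ - _; have [|y yE] := @tangentP q'.
  by rewrite minkBl minkZl divfK// subrr.
have : gdot (G u) y y = 0.
  by rewrite gdot_induced// {1}yE minkBl minkZl qT pT mulr0 subrr.
by move=> /(gdot_eq0 Uu) y0; rewrite -yE y0 derive0.
Qed.

(** With [B] the field [nabla_y z], the products of [D_B X] and of [D_y D_z X] with
    a tangent vector agree on all of [U].  Differentiating this identity along
    [x] avoids differentiating a normal field. *)
Lemma gdot_cov2 x y z w : gdot (G u) (cov G x (cov G y (cst z)) u) w =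
  mink ('D_x ('D_y ('D_z X)) u) ('D_w X u) +
  mink p ('D_y ('D_z X) u) * mink p ('D_x ('D_w X) u) / mink p p.
Proof.
set B := cov G y (cst z).
have BE : {in U, (fun t => sharp t ('D_y ('D_z X) t)) =1 B}.
  by move=> t /set_mem Ut; rewrite /B covE// derive_cst add0r.
have sB : smooth_on U B.
  by apply: (smooth_on_eq oU BE); apply: smooth_sharp; do 2! apply: smooth_on_derive.
have dB : differentiable B u by exact: smooth_on_diff sB _ Uu.
pose A t := 'D_(B t) X t; pose Q := 'D_y ('D_z X); pose W := 'D_w X.
have AQ w' t : U t -> mink (A t) ('D_w' X t) = mink (Q t) ('D_w' X t).
  move=> Ut; apply: etrans (esym (gdot_induced (B t) w' Ut)) _.
  rewrite -(BE t (mem_set Ut)); exact: gdot_sharp.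
have dA : differentiable A u := (derive_moving x oU sX Uu dB).1.
have dQ : differentiable Q u := immersion_diffDD y z Uu.
have dW : differentiable W u := immersion_diffD w Uu.
have D : 'D_x (fun t => mink (A t) (W t)) u = 'D_x (fun t => mink (Q t) (W t)) u.
  by apply: (derive_eq_on oU) (mem_set Uu) => t /set_mem Ut; exact: AQ.
apply: etrans (gdot_cov x w Uu dB) _.
apply: (normal_correction pp (a := A u) (q := Q u) (d := 'D_x W u)).
- exact: etrans (esym (derive_mink x dA dW)) (etrans D (derive_mink x dQ dW)).
- exact: pT.
- apply: normalP => w'; apply: etrans (minkBl _ _ _) _.
  by apply/eqP; rewrite subr_eq0; apply/eqP/esym/AQ.
Qed.

(** The third derivatives cancel by symmetry, and the products of second
    fundamental forms remain. *)
Lemma gauss_equation x y z w : curv4 G u x y z w =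
  (mink p ('D_y ('D_z X) u) * mink p ('D_x ('D_w X) u)
   - mink p ('D_x ('D_z X) u) * mink p ('D_y ('D_w X) u)) / mink p p.
Proof.
rewrite /curv4 /curv gdotB//.
apply: etrans (congr2 (fun a b => a - b) (gdot_cov2 x y z w) (gdot_cov2 y x z w)) _.
have sw : 'D_x ('D_y ('D_z X)) u = 'D_y ('D_x ('D_z X)) u.
  exact: derive_swap_mx x y oU (smooth_on_derive z sX) Uu.
have alg (a b c d e : R) : a = b -> a + c / e - (b + d / e) = (c - d) / e.
  by move=> ->; ring.
exact: alg (congr1 (fun q => mink q _) sw).
Qed.

End Normal.
End Immersion.

(** * Quasi-constant curvature from the form of the curvature tensor *)

Section QuasiConstant.
Context {R : realType} {n : nat}.
Notation E := 'rV[R]_n.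
Notation V := 'rV[R]_n.+1.

(** Bessel's inequality: it makes the cosine of the angle between a unit vector
    and a plane a number between 0 and 1. *)
Lemma bessel2 (U : set E) (X : E -> V) u (e x y : E) : smooth_on U X ->
  (forall v, v != 0 -> 0 < gdot (induced_metric X u) v v) -> U u ->
  gdot (induced_metric X u) e e = 1 -> orthonormal2 (induced_metric X u) x y ->
  gdot (induced_metric X u) e x ^+ 2 + gdot (induced_metric X u) e y ^+ 2 <= 1.
Proof.
move=> sX posG Uu ee [xx yy xy].
set G := induced_metric X u; set a := gdot G e x; set b := gdot G e y.
pose q := e - a *: x - b *: y.
have qw w : gdot G q w = gdot G e w - a * gdot G x w - b * gdot G y w.
  by rewrite /q /G !(gdotB sX)// !(gdotZ sX).
have : 0 <= gdot G q q.
  have [->|/posG/ltW//] := eqVneq q 0.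
  by rewrite /G (gdot_induced sX)// derive0 mink0l.
have yx : gdot G y x = 0 by rewrite /G (gdotC sX).
have qx : gdot G q x = 0 by rewrite qw -/a xx yx; ring.
have qy : gdot G q y = 0 by rewrite qw -/b yy xy; ring.
have qC w : gdot G w q = gdot G q w by exact: (gdotC sX).
rewrite {1}qw !qC qx qy !mulr0 !subr0 qw ee -/G (gdotC sX x e Uu) (gdotC sX y e Uu).
rewrite -/a -/b; lra.
Qed.

(** On an orthonormal pair the curvature is [a + b c], where [c] is the squared
    length of the projection of [xi], that is the squared cosine of the angle. *)
Lemma QC_curvature_riemannian_QC (M : set V) (xi : V -> V) (a b : V -> R) :
  spacelike_hypersurface M -> unit_tangent_field M xi ->
  QC_curvature M xi a b -> riemannian_QC M xi.
Proof.
move=> [_ pos] uxi qc; split=> //.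
exists (fun p t => a p + b p * cos t ^+ 2) => U X Y u x y cX cY Uu oxy.
have sX := chart_smooth cX.
have [Y0 [_ cY0 Y01]] := uxi U X cX.
have YY : gdot (induced_metric X u) (Y u) (Y u) = 1.
  apply: etrans (Y01 u Uu); apply: etrans (gdot_induced sX (Y u) (Y u) Uu) _.
  apply: esym (etrans (gdot_induced sX (Y0 u) (Y0 u) Uu) _).
  by rewrite (cY u Uu) (cY0 u Uu).
have posu v := pos U X u v cX Uu.
have := bessel2 sX posu Uu YY oxy.
rewrite /sectional (qc U X Y u x y y x cX cY Uu) /pi_tensor /Phi_tensor /angle_plane.
case: oxy => xx yy xy.
have yx : gdot (induced_metric X u) y x = 0 by rewrite (gdotC sX).
rewrite xx yy xy yx.
set c := gdot _ _ x; set d := gdot _ _ y => cd1.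
have cd0 : 0 <= c ^+ 2 + d ^+ 2 by rewrite addr_ge0 ?sqr_ge0.
rewrite acosK; last first.
  rewrite in_itv /= (le_trans _ (sqrtr_ge0 _)) ?lerN10//=.
  by rewrite -sqrtr1 ler_wsqrtr.
rewrite sqr_sqrtr//; ring.
Qed.

End QuasiConstant.

(** * Canal hypersurfaces of parabolic type *)

Lemma smooth_on_derive1 {R : realType} {W : normedModType R} (J : set R)
  (f : R -> W) : smooth_on J f -> smooth_on J (derive1 f).
Proof.
have -> : derive1 f = 'D_1 f by apply/funext => t; rewrite derive1E.
exact: smooth_on_derive.
Qed.

Section Canal.
Context {R : realType} {n : nat}.
Notation E := 'rV[R]_n.
Notation V := 'rV[R]_n.+1.
Variables (M : set V) (J : set R) (sigma : V -> R) (z : R -> V) (rad : R -> R).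
Hypothesis hM : canal_hypersurface M J sigma z rad.
Hypothesis hpar : parabolic_type J z.

Notation z' := (derive1 z).
Notation z'' := (derive1 (derive1 z)).
Notation r' := (derive1 rad).
Notation r'' := (derive1 (derive1 rad)).

(** The differential of [sigma] is dual to the projection of [z'] on the tangent
    space, up to this factor. *)
Definition canal_lambda (p : V) : R := let s := sigma p in
  r' s ^+ 2 + rad s * r'' s - mink (p - z s) (z'' s).

(** The length of [z' - r' N], which is [|r'|] because [z'] is light-like; the
    square root is smooth wherever [r'] does not vanish. *)
Definition canal_xi_norm (s : R) : R := Num.sqrt (r' s ^+ 2).

(** The coefficient of the position vector [Z - z] in [xi]. *)
Definition canal_radial_coef (s : R) : R := (canal_xi_norm s)^-1 * (r' s / rad s).

Lemma canal_xi_norm2 s : canal_xi_norm s ^+ 2 = r' s ^+ 2.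
Proof. by rewrite sqr_sqrtr// sqr_ge0. Qed.

Section InChart.
Variables (U : set E) (X : E -> V).
Hypothesis cX : chart M U X.

Let oU : open U := chart_open cX.
Let sX : smooth_on U X := chart_smooth cX.
Let oJ : open J := canal_open hM.
Let sz : smooth_on J z := canal_center_smooth hM.
Let sr : smooth_on J rad := canal_radius_smooth hM.
Let sz' : smooth_on J z' := smooth_on_derive1 sz.
Let sr' : smooth_on J r' := smooth_on_derive1 sr.

Let S (u : E) := sigma (X u).
(* The position vector relative to the center; it is normal and time-like. *)
Let P (u : E) := X u - z (S u).

Let posG u v : U u -> v != 0 -> 0 < gdot (induced_metric X u) v v.
Proof. by move=> Uu; exact: (canal_spacelike hM).2 cX Uu. Qed.

Let sS : smooth_on U S := canal_smooth hM cX.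

Let SJ u : U u -> J (S u).
Proof. by move=> /(chart_in cX); exact: canal_param hM _. Qed.

Let dS u : U u -> differentiable S u. Proof. exact: smooth_on_diff. Qed.

Let dX u : U u -> differentiable X u. Proof. exact: smooth_on_diff. Qed.

Let dcomp (W : normedModType R) (h : R -> W) u : smooth_on J h -> U u ->
  differentiable (h \o S) u.
Proof.
move=> sh Uu; apply: differentiable_comp; first exact: dS.
exact/(smooth_on_diff sh)/SJ.
Qed.

Let Dcomp (W : normedModType R) (h : R -> W) u v : smooth_on J h -> U u ->
  'D_v (h \o S) u = 'D_v S u *: derive1 h (S u).
Proof.
move=> sh Uu; apply: derive_comp1; first exact: dS.
exact/(smooth_on_diff sh)/SJ.
Qed.

Let P_E : P = X - (z \o S). Proof. by []. Qed.

Let dP u : U u -> differentiable P u.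
Proof. by move=> Uu; apply: differentiableB; [exact: dX|exact: dcomp]. Qed.

Let DP u v : U u -> 'D_v P u = 'D_v X u - 'D_v S u *: z' (S u).
Proof.
move=> Uu; rewrite P_E deriveB; [|exact/diff_derivable/dX|exact/diff_derivable/dcomp].
by rewrite Dcomp.
Qed.

Let generatorS u : U u -> generator M sigma (S u) (X u).
Proof. by move=> Uu; split=> //; exact: chart_in cX _ Uu. Qed.

Lemma canal_position_norm u : U u -> mink (P u) (P u) = - rad (S u) ^+ 2.
Proof. by move=> Uu; apply: (canal_radius hM (SJ Uu)); exact: generatorS. Qed.

Lemma canal_position_normal u v : U u -> mink (P u) ('D_v X u) = 0.
Proof.
move=> Uu; have := canal_normals hM (SJ Uu) (generatorS Uu) v cX Uu erefl.
by rewrite -opprB minkNl => /eqP; rewrite oppr_eq0 => /eqP.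
Qed.

Lemma canal_radius_neq0 u : U u -> rad (S u) != 0.
Proof. by move=> Uu; rewrite lt0r_neq0//; exact: canal_radius_gt0 hM _ (SJ Uu). Qed.

(** This is the derivative of [canal_position_norm], taken in a direction in which
    [sigma] is not stationary. *)
Lemma canal_position_center u : U u -> mink (P u) (z' (S u)) = rad (S u) * r' (S u).
Proof.
move=> Uu; have [v v0] := canal_regular hM cX Uu.
have dr := dcomp sr Uu.
have E : 'D_v (fun t => mink (P t) (P t)) u = 'D_v (- ((rad \o S) * (rad \o S))) u.
  apply: (derive_eq_on oU) (mem_set Uu) => t /set_mem Ut.
  by apply: etrans (canal_position_norm Ut) _; rewrite expr2.
move: E; rewrite deriveN; last exact/diff_derivable/differentiableM.
rewrite deriveM; [|exact: diff_derivable..].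
move=> /(etrans (esym (derive_mink v (dP Uu) (dP Uu)))).
rewrite (Dcomp v sr Uu) (DP v Uu).
rewrite (minkC _ (P u)) minkBr (canal_position_normal _ Uu) minkZr /=.
rewrite -![_ *: _]/(_ * _) => H; apply: (mulfI v0).
rewrite -[X in X * _ = _]/('D_v S u) -[X in _ = X * _]/('D_v S u).
by move: H; lra.
Qed.

(** Otherwise the time-like vector [P] would be orthogonal to the nonzero
    light-like vector [z']. *)
Lemma canal_radius_derive_neq0_chart u : U u -> r' (S u) != 0.
Proof.
move=> Uu; have [z0 zz] := hpar (SJ Uu); apply: contra z0 => /eqP r0.
apply/eqP/(mink_timelike_lightlike _ zz (p := P u)).
  by rewrite canal_position_norm// oppr_lt0 exprn_gt0//; exact: canal_radius_gt0 hM _ (SJ Uu).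
by rewrite canal_position_center// r0 mulr0.
Qed.

(** The derivative of [canal_position_center]; the term in [mink z' z'] drops out
    because [z'] is light-like. *)
Lemma canal_tangent_center u v : U u ->
  mink ('D_v X u) (z' (S u)) = canal_lambda (X u) * 'D_v S u.
Proof.
move=> Uu; have [_ zz] := hpar (SJ Uu).
have E : 'D_v (fun t => mink (P t) ((z' \o S) t)) u = 'D_v ((rad \o S) * (r' \o S)) u.
  apply: (derive_eq_on oU) (mem_set Uu) => t /set_mem Ut.
  exact: canal_position_center Ut.
move: E; rewrite deriveM; [|exact/diff_derivable/dcomp..].
move=> /(etrans (esym (derive_mink v (dP Uu) (dcomp sz' Uu)))).
rewrite (Dcomp v sr Uu) (Dcomp v sr' Uu) (Dcomp v sz' Uu) (DP v Uu).
rewrite minkBl minkZl zz mulr0 subr0 minkZr /=.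
rewrite -![_ *: _]/(_ * _) /canal_lambda -/(S u) -/(P u) => H.
by rewrite -[LHS](addrK ('D_v S u * mink (P u) (z'' (S u)))) H; ring.
Qed.

(** The derivative of [canal_position_normal]: the second fundamental form is a
    combination of the metric and of the square of the differential of [sigma]. *)
Lemma canal_second_form u y w : U u -> mink (P u) ('D_y ('D_w X) u) =
  canal_lambda (X u) * 'D_y S u * 'D_w S u - mink ('D_y X u) ('D_w X u).
Proof.
move=> Uu.
have E : 'D_y (fun t => mink (P t) ('D_w X t)) u = 'D_y (cst 0 : E -> R) u.
  apply: (derive_eq_on oU) (mem_set Uu) => t /set_mem Ut.
  exact: canal_position_normal Ut.
move: E; rewrite derive_cst.
have dXw : differentiable ('D_w X) u := smooth_on_diff (smooth_on_derive w sX) Uu.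
move=> /(etrans (esym (derive_mink y (dP Uu) dXw))).
rewrite (DP y Uu) minkBl minkZl (minkC (z' _)) (canal_tangent_center w Uu) => H.
rewrite -[LHS](addKr (mink ('D_y X u) ('D_w X u) - 'D_y S u * (canal_lambda (X u) * 'D_w S u))).
rewrite H addr0; ring.
Qed.

Lemma canal_position_timelike u : U u -> mink (P u) (P u) < 0.
Proof.
move=> Uu; rewrite canal_position_norm// oppr_lt0 exprn_gt0//.
exact: canal_radius_gt0 hM _ (SJ Uu).
Qed.

Lemma canal_tangent u q : U u -> mink q (P u) = 0 -> exists y, 'D_y X u = q.
Proof.
move=> Uu; apply: (tangentP sX posG Uu) => [|v]; last exact: canal_position_normal.
by rewrite lt_eqF// canal_position_timelike.
Qed.

Lemma canal_xi_expand u : U u -> canal_xi sigma z rad (X u) =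
  (canal_xi_norm (S u))^-1 *: z' (S u) + canal_radial_coef (S u) *: P u.
Proof.
move=> Uu; rewrite /canal_xi /canal_normal -/(S u) -/(P u).
have r0 := canal_radius_neq0 Uu.
have vE : z' (S u) - r' (S u) *: - ((rad (S u))^-1 *: P u) =
    z' (S u) + (r' (S u) / rad (S u)) *: P u.
  by rewrite scalerN opprK scalerA.
rewrite {}vE; have -> : mink (z' (S u) + (r' (S u) / rad (S u)) *: P u)
    (z' (S u) + (r' (S u) / rad (S u)) *: P u) = r' (S u) ^+ 2.
  rewrite minkDl !minkDr !minkZl !minkZr (minkC (z' _)) (canal_position_center Uu) (canal_position_norm Uu).
  by rewrite (hpar (SJ Uu)).2; field.
by rewrite scalerDr scalerA.
Qed.

Lemma canal_xi_norm_neq0 u : U u -> canal_xi_norm (S u) != 0.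
Proof.
by move=> Uu; rewrite -sqrf_eq0 canal_xi_norm2// expf_neq0// canal_radius_derive_neq0_chart.
Qed.

Lemma canal_xi_normal u : U u -> mink (canal_xi sigma z rad (X u)) (P u) = 0.
Proof.
move=> Uu; rewrite canal_xi_expand// minkDl !minkZl (minkC (z' _)) canal_position_center// canal_position_norm//.
rewrite /canal_radial_coef; have := canal_radius_neq0 Uu; have := canal_xi_norm_neq0 Uu => ? ?.
by field; apply/andP.
Qed.

Lemma canal_xi_tangent u v : U u -> mink (canal_xi sigma z rad (X u)) ('D_v X u) =
  (canal_xi_norm (S u))^-1 * (canal_lambda (X u) * 'D_v S u).
Proof.
move=> Uu; rewrite canal_xi_expand// minkDl !minkZl canal_position_normal// mulr0 addr0.
by rewrite minkC canal_tangent_center.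
Qed.

Lemma canal_xi_unit u : U u ->
  mink (canal_xi sigma z rad (X u)) (canal_xi sigma z rad (X u)) = 1.
Proof.
move=> Uu; rewrite {2}canal_xi_expand// minkDr !minkZr canal_xi_normal// mulr0 addr0.
rewrite canal_xi_expand// minkDl !minkZl (hpar (SJ Uu)).2 mulr0 add0r canal_position_center//.
have := canal_radius_neq0 Uu; have := canal_xi_norm_neq0 Uu => s0 r0.
rewrite /canal_radial_coef.
have -> : (canal_xi_norm (S u))^-1 * ((canal_xi_norm (S u))^-1 * (r' (S u) / rad (S u)) *
  (rad (S u) * r' (S u))) = r' (S u) ^+ 2 / canal_xi_norm (S u) ^+ 2.
  by field; apply/andP.
by rewrite canal_xi_norm2// divff// expf_neq0// canal_radius_derive_neq0_chart.
Qed.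

(** [xi] is tangent and its product with itself is a multiple of [canal_lambda],
    which therefore cannot vanish. *)
Lemma canal_lambda_neq0 u : U u -> canal_lambda (X u) != 0.
Proof.
move=> Uu; have [y yE] := canal_tangent Uu (canal_xi_normal Uu).
have := canal_xi_tangent y Uu; rewrite yE canal_xi_unit// => H.
by apply/eqP => l0; move: H; rewrite l0 mul0r mulr0 => /eqP; rewrite oner_eq0.
Qed.

Lemma components_gdot Y u v : components U X (canal_xi sigma z rad) Y -> U u ->
  gdot (induced_metric X u) (Y u) v =
  (canal_xi_norm (S u))^-1 * (canal_lambda (X u) * 'D_v S u).
Proof. by move=> cY Uu; rewrite (gdot_induced sX)// cY// canal_xi_tangent. Qed.

Lemma canal_components_sharp : components U X (canal_xi sigma z rad)
  (fun u => sharp X u (canal_xi sigma z rad (X u))).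
Proof.
move=> u Uu; have [y yE] := canal_tangent Uu (canal_xi_normal Uu).
rewrite -yE; congr ('D_ _ X u); apply: (gdot_inj sX posG Uu) => w.
by rewrite (gdot_sharp sX posG)// (gdot_induced sX).
Qed.

Lemma components_unique Y Y' : components U X (canal_xi sigma z rad) Y ->
  components U X (canal_xi sigma z rad) Y' -> {in U, Y =1 Y'}.
Proof.
move=> cY cY' u /set_mem Uu; apply: (gdot_inj sX posG Uu) => w.
by rewrite !components_gdot.
Qed.

(** Along a direction tangent to the spherical generator only the position vector
    varies. *)
Lemma derive_canal_xi (al be : R -> R) u v : smooth_on J al -> smooth_on J be ->
  U u -> 'D_v S u = 0 ->
  'D_v (fun t => al (S t) *: z' (S t) + be (S t) *: P t) u = be (S u) *: 'D_v X u.
Proof.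
move=> sal sbe Uu S0.
have C0 (W : normedModType R) (h : R -> W) : smooth_on J h -> 'D_v (h \o S) u = 0.
  by move=> sh; rewrite (Dcomp v sh Uu) S0 scale0r.
have [d1 D1] := derive_scale v (dcomp sal Uu) (dcomp sz' Uu).
have [d2 D2] := derive_scale v (dcomp sbe Uu) (dP Uu).
apply: etrans (deriveD (diff_derivable d1) (diff_derivable d2)) _.
rewrite D1 D2 (C0 _ _ sal) (C0 _ _ sz') (C0 _ _ sbe) (DP v Uu) S0.
by rewrite !scale0r scaler0 subr0 !add0r.
Qed.

Lemma smooth_canal_xi_coefs : (forall s, J s -> r' s != 0) ->
  smooth_on J (fun s => (canal_xi_norm s)^-1) /\ smooth_on J canal_radial_coef.
Proof.
move=> r0.
have ss : smooth_on J (fun s => (canal_xi_norm s)^-1).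
  apply: smooth_on_inv => //.
    apply: smooth_on_sqrt => //; first exact: (smooth_on_mul oJ sr' sr').
    by move=> s Js; rewrite exprn_even_gt0//= r0.
  by move=> s Js; rewrite -sqrf_eq0 canal_xi_norm2 expf_neq0 ?r0.
split=> //; apply: (smooth_on_mul oJ ss (smooth_on_mul oJ sr' _)).
by apply: smooth_on_inv => // s Js; rewrite lt0r_neq0//; exact: canal_radius_gt0 hM _ Js.
Qed.

End InChart.
End Canal.

Section CanalParabolic.
Context {R : realType} {n : nat}.
Notation E := 'rV[R]_n.
Notation V := 'rV[R]_n.+1.
Variables (M : set V) (J : set R) (sigma : V -> R) (z : R -> V) (rad : R -> R).
Hypothesis hM : canal_hypersurface M J sigma z rad.
Hypothesis hpar : parabolic_type J z.

Let xi := canal_xi sigma z rad.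

Lemma canal_radius_derive_neq0 s : J s -> derive1 rad s != 0.
Proof.
move=> Js; have [[p [Mp <-]] _] := canal_generator hM Js.
have [U [X [u [cX Uu <-]]]] := (canal_spacelike hM).1 p Mp.
exact: (canal_radius_derive_neq0_chart hM hpar cX Uu).
Qed.

(** The components are obtained from [xi] by raising an index, which only involves
    the inverse of the metric. *)
Lemma canal_smooth_components U X : chart M U X ->
  smooth_on U (fun u => sharp X u (xi (X u))).
Proof.
move=> cX; have sX := chart_smooth cX; have oU := chart_open cX.
have posG t v : U t -> v != 0 -> 0 < gdot (induced_metric X t) v v.
  by move=> Ut; exact: (canal_spacelike hM).2 cX Ut.
have sS := canal_smooth hM cX.
have SJ u : U u -> J ((sigma \o X) u).
  by move=> /(chart_in cX); exact: canal_param hM _.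
have oJ := canal_open hM.
have [sa sb] := smooth_canal_xi_coefs hM canal_radius_derive_neq0.
have sz := canal_center_smooth hM.
apply: (smooth_sharp oU sX posG).
pose S := sigma \o X.
apply: (@smooth_on_eq _ _ _ _ oU (fun u => (canal_xi_norm rad (S u))^-1 *: derive1 z (S u)
    + canal_radial_coef rad (S u) *: (X u + (-1) *: z (S u)))).
  move=> u /set_mem Uu; rewrite /xi (canal_xi_expand hM hpar cX Uu).
  by rewrite scaleN1r.
apply: smooth_on_addmx => //; apply: smooth_on_scalemx => //.
- exact: (smooth_on_comp oU sa sS SJ).
- exact: (smooth_on_compmx oU oJ (smooth_on_derive1 sz) sS SJ).
- exact: (smooth_on_comp oU sb sS SJ).
apply: smooth_on_addmx => //; apply: smooth_on_scalemx => //.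
  exact: smooth_on_cst.
exact: (smooth_on_compmx oU oJ sz sS SJ).
Qed.

Lemma canal_unit_tangent_field : unit_tangent_field M xi.
Proof.
move=> U X cX; exists (fun u => sharp X u (xi (X u))); split.
- exact: canal_smooth_components.
- exact: (canal_components_sharp hM hpar cX).
- move=> u Uu; rewrite (gdot_induced (chart_smooth cX))//.
  by rewrite (canal_components_sharp hM hpar cX Uu) (canal_xi_unit hM hpar cX Uu).
Qed.

Definition canal_a (p : V) : R := - (rad (sigma p) ^+ 2)^-1.

Definition canal_b (p : V) : R := derive1 rad (sigma p) ^+ 2 /
  (canal_lambda sigma z rad p * rad (sigma p) ^+ 2).

Definition canal_k (p : V) : R := canal_radial_coef rad (sigma p).

(** The second fundamental form is a combination of [g] and [eta * eta]; in the
    Gauss equation its square contributes multiples of [pi] and [Phi] only, as the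
    terms of degree four in [eta] cancel. *)
Lemma canal_QC_curvature : QC_curvature M xi canal_a canal_b.
Proof.
move=> U X Y u x y z0 w cX cY Uu G.
have sX := chart_smooth cX.
have posG t v : U t -> v != 0 -> 0 < gdot (induced_metric X t) v v.
  by move=> Ut; exact: (canal_spacelike hM).2 cX Ut.
have PP := canal_position_timelike hM cX Uu.
apply: etrans (gauss_equation (chart_open cX) sX posG Uu (negbT (lt_eqF PP))
  (fun v => canal_position_normal hM cX v Uu) x y z0 w) _.
have r0 := canal_radius_neq0 hM cX Uu.
have s0 := canal_xi_norm_neq0 hM hpar cX Uu.
have l0 := canal_lambda_neq0 hM hpar cX Uu.
set sp := canal_xi_norm rad (sigma (X u)) in s0.
set la := canal_lambda sigma z rad (X u) in l0.
have hE v t : mink (X u - z (sigma (X u))) ('D_v ('D_t X) u) =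
    sp ^+ 2 / la * gdot G (Y u) v * gdot G (Y u) t - gdot G v t.
  apply: etrans (canal_second_form hM hpar cX v t Uu) _.
  congr (_ - _); last exact: esym (gdot_induced sX v t Uu).
  rewrite /G !(components_gdot hM hpar cX _ cY Uu) -/sp -/la.
  by field; apply/andP.
have subst_all (a b c d e a' b' c' d' e' : R) : a = a' -> b = b' -> c = c' ->
    d = d' -> e = e' -> (a * b - c * d) / e = (a' * b' - c' * d') / e'.
  by move=> -> -> -> -> ->.
apply: etrans (subst_all _ _ _ _ _ _ _ _ _ _ (hE y z0) (hE x w) (hE x z0) (hE y w)
  (canal_position_norm hM cX Uu)) _.
rewrite /canal_a /canal_b -canal_xi_norm2 -/sp -/la /pi_tensor /Phi_tensor.
by field; apply/andP.
Qed.

(** A vector orthogonal to [xi] is tangent to the spherical generator, along which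
    [xi] varies like the multiple [canal_k *: P] of the position vector. *)
Lemma canal_QC_k : QC_k M xi canal_k.
Proof.
move=> U X Y u x cX cY Uu Yx.
have sX := chart_smooth cX; have oU := chart_open cX.
have posG t v : U t -> v != 0 -> 0 < gdot (induced_metric X t) v v.
  by move=> Ut; exact: (canal_spacelike hM).2 cX Ut.
have dS0 : 'D_x (fun t => sigma (X t)) u = 0.
  move: Yx; rewrite (components_gdot hM hpar cX x cY Uu) => /eqP.
  rewrite !mulf_eq0 invr_eq0 (negPf (canal_xi_norm_neq0 hM hpar cX Uu)).
  by rewrite (negPf (canal_lambda_neq0 hM hpar cX Uu)) => /eqP.
have dY : differentiable Y u.
  apply: (differentiable_eq_on oU _ Uu) (smooth_on_diff (canal_smooth_components cX) Uu).
  exact: (components_unique hM hpar cX (canal_components_sharp hM hpar cX) cY).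
apply: (gdot_inj sX posG Uu) => w.
rewrite (gdotZ sX)// (gdot_induced sX x w Uu).
apply: etrans (gdot_cov oU sX posG x w Uu dY) _.
rewrite -minkZl; congr (mink _ _).
have [sa sb] := smooth_canal_xi_coefs hM canal_radius_derive_neq0.
apply: etrans (derive_canal_xi hM cX sa sb Uu dS0).
apply: (derive_eq_on oU) (mem_set Uu) => t /set_mem Ut.
exact: etrans (cY t Ut) (canal_xi_expand hM hpar cX Ut).
Qed.

Lemma canal_a_plus_k2 p : M p -> canal_a p + canal_k p ^+ 2 = 0.
Proof.
move=> Mp; have [U [X [u [cX Uu <-]]]] := (canal_spacelike hM).1 p Mp.
have r0 := canal_radius_neq0 hM cX Uu.
have s0 := canal_xi_norm_neq0 hM hpar cX Uu.
rewrite /canal_a /canal_k /canal_radial_coef exprMn exprVn expr_div_n.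
rewrite -canal_xi_norm2.
by field; apply/andP.
Qed.

End CanalParabolic.

Theorem proposition3p12 (R : realType) (n : nat) (hn : (4 <= n)%N)
    (M : set 'rV[R]_n.+1) (J : set R) (sigma : 'rV[R]_n.+1 -> R)
    (z : R -> 'rV[R]_n.+1) (rad : R -> R)
    (hM : canal_hypersurface M J sigma z rad)
    (hpar : parabolic_type J z) :
  let xi := canal_xi sigma z rad in
  riemannian_QC M xi /\
  exists a b k : 'rV[R]_n.+1 -> R,
    [/\ QC_curvature M xi a b, QC_k M xi k &
        forall p, M p -> a p + k p ^+ 2 = 0].
Proof.
move=> xi; have qc := canal_QC_curvature hM hpar; split.
  exact: QC_curvature_riemannian_QC (canal_spacelike hM)
    (canal_unit_tangent_field hM hpar) qc.
by do 3 eexists; split; [exact: qc|exact: canal_QC_k hM hpar|exact: canal_a_plus_k2 hM hpar].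
Qed.
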